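(* Let $\alpha \in (0,\pi]$, $\beta \in [0,\pi)$, let $p$ and $\tilde p$ be two density functions on $[0,1]$, and fix an integer $n>0$. Let $\lambda_n = \lambda_n(p,\alpha,\beta)$ and $\tilde\lambda_n = \lambda_n(\tilde p,\alpha,\beta)$ be the $n$-th eigenvalues of $S(p,\alpha,\beta)$ and $S(\tilde p,\alpha,\beta)$, let $\tilde\varphi_n$ be the eigenfunction of $S(\tilde p,\alpha,\beta)$ corresponding to $\tilde\lambda_n$ with $\tilde\varphi_n(0)=\sin\alpha$, $\tilde\varphi_n'(0)=-\cos\alpha$, and put $\check p=\tilde p/p$. Assume $\lambda_n\neq 0$. If $$\lambda_n = \tilde\lambda_n\, \frac{(\check p\,\tilde\varphi_n,\tilde\varphi_n)}{(\tilde\varphi_n,\tilde\varphi_n)} \qquad\text{and}\qquad \lambda_n = \tilde\lambda_n\max_{x\in[0,1]}\check p(x),$$ then $p(x) = \dfrac{\tilde\lambda_n}{\lambda_n}\,\tilde p(x)$ on $[0,1]$.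
   Context: A density function is a real-valued, piecewise continuous, positive function on $[0,1]$ that is bounded away from $0$. For a density function $p$ and $\alpha\in(0,\pi]$, $\beta\in[0,\pi)$, $S(p,\alpha,\beta)$ denotes the self-adjoint operator generated by the boundary value problem (vibrating string equation) $$-u'' = \lambda p(x) u,\quad x\in(0,1),\ \lambda\in\mathbb{C},$$ $$u(0)\cos\alpha + u'(0)\sin\alpha = 0,\qquad u(1)\cos\beta + u'(1)\sin\beta = 0.$$ Its spectrum is discrete and consists of real, simple eigenvalues, denoted $\lambda_0(p,\alpha,\beta) < \lambda_1(p,\alpha,\beta) < \cdots < \lambda_n(p,\alpha,\beta) < \cdots$. The inner product is $(y,z)=\int_0^1 y(x)\overline{z(x)}\,dx$.
   Formalization: Values of a piecewise continuous density at jumps being arbitrary, equality can fail there; it is proved at every x in [0,1] where both densities are continuous, and at all x in [0,1] if both take their values at jumps by one common rule and are one-sided continuous at 0 and 1. *)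

(* Defs.v *)
From Stdlib Require Import Reals List.
From Coquelicot Require Import Coquelicot.
Open Scope R_scope.

(* Functions on [0,1] are total functions on R whose values outside [0,1] are
   never looked at. *)
Definition I01 (x : R) : Prop := 0 <= x <= 1.

Definition continuous_in01 (f : R -> R) (x : R) : Prop :=
  filterlim f (within I01 (locally x)) (locally (f x)).

(* Finitely many discontinuities, all of them jumps; the value at a jump is
   arbitrary. *)
Definition piecewise_continuous (f : R -> R) : Prop :=
  (exists s : list R, forall x, I01 x -> ~ In x s -> continuous_in01 f x) /\
  (forall x, 0 <= x < 1 -> exists r : R, filterlim f (at_right x) (locally r)) /\
  (forall x, 0 < x <= 1 -> exists l : R, filterlim f (at_left x) (locally l)).

Definition density (p : R -> R) : Prop :=
  piecewise_continuous p /\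
  (forall x, I01 x -> 0 < p x) /\
  (exists m : R, 0 < m /\ forall x, I01 x -> m <= p x).

(* A rule fixing the value of a piecewise continuous function at each interior
   point from its two one-sided limits: theta = 1 is right-continuity,
   theta = 0 left-continuity, theta = 1/2 the mean value. *)
Definition jump_convention (theta : R -> R) (f : R -> R) : Prop :=
  filterlim f (at_right 0) (locally (f 0)) /\
  filterlim f (at_left 1) (locally (f 1)) /\
  forall x, 0 < x < 1 ->
    exists l r : R,
      filterlim f (at_left x) (locally l) /\
      filterlim f (at_right x) (locally r) /\
      f x = (1 - theta x) * l + theta x * r.

(* [du] is the derivative of [u].  Both are continuous on the closed interval,
   so by the mean value theorem [du 0] and [du 1] are the one-sided derivatives
   of [u] at the endpoints.  As [du] is continuous and [p] has finitely many
   discontinuities, asking for the equation at the continuity points of [p] is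
   the same as asking that [du] be absolutely continuous and the equation hold
   almost everywhere. *)
Definition string_solution (p : R -> R) (lambda : C) (u du : R -> C) : Prop :=
  continuous_on I01 u /\
  continuous_on I01 du /\
  (forall x, 0 < x < 1 ->
     is_derive (K := R_AbsRing) (V := C_R_NormedModule) u x (du x)) /\
  (forall x, 0 < x < 1 -> continuous p x ->
     exists d2u : C,
       is_derive (K := R_AbsRing) (V := C_R_NormedModule) du x d2u /\
       (- d2u = lambda * RtoC (p x) * u x)%C).

Definition string_bvp (p : R -> R) (alpha beta : R) (lambda : C)
    (u du : R -> C) : Prop :=
  string_solution p lambda u du /\
  (u 0 * RtoC (cos alpha) + du 0 * RtoC (sin alpha) = RtoC 0)%C /\
  (u 1 * RtoC (cos beta) + du 1 * RtoC (sin beta) = RtoC 0)%C.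

Definition eigenfunction (p : R -> R) (alpha beta : R) (lambda : C)
    (u du : R -> C) : Prop :=
  string_bvp p alpha beta lambda u du /\
  exists x, I01 x /\ u x <> RtoC 0.

Definition eigenvalue (p : R -> R) (alpha beta : R) (lambda : C) : Prop :=
  exists u du : R -> C, eigenfunction p alpha beta lambda u du.

(* [lam 0 < lam 1 < ...] lists all the eigenvalues; at most one sequence does. *)
Definition eigenvalue_sequence (p : R -> R) (alpha beta : R)
    (lam : nat -> R) : Prop :=
  (forall k : nat, lam k < lam (S k)) /\
  (forall mu : C, eigenvalue p alpha beta mu <-> exists k : nat, mu = RtoC (lam k)).

Definition inner (y z : R -> C) : C :=
  RInt (V := C_R_CompleteNormedModule) (fun x => (y x * Cconj (z x))%C) 0 1.

Definition is_max01 (f : R -> R) (M : R) : Prop :=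
  (exists x, I01 x /\ f x = M) /\ (forall x, I01 x -> f x <= M).

(* Main.v *)
Require Import Defs.
From Stdlib Require Import Reals List Lra Classical.
From Coquelicot Require Import Coquelicot.
Open Scope R_scope.
Set Bullet Behavior "Strict Subproofs".

(** The identity with inner products says that [lam n / lamt n] is the mean of
    [pc = pt / p] for the weight [|phi|^2]; the other one says that it is the
    maximum [M] of [pc].  Hence [(M - pc) |phi|^2] is nonnegative with integral
    zero, and vanishes wherever it is continuous.  A mean can equal the maximum
    only if [pc = M] on the support of the weight
    ([weighted_mean_eq_max]), and here the weight has full support: an
    eigenfunction that vanished on an interval would have zero Cauchy data at a
    point of it, hence would vanish on the whole of (0,1)
    ([string_solution_zero_interval]), and [(phi, phi)] would be zero.  In that
    case the quotient of inner products would be zero as well, and so would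
    [lam n].

    This gives [pt = M p] on (0,1) off a finite set.  One-sided limits carry
    the equality to the remaining points
    ([proportional_off_finite_extends]): to the points where both densities are
    continuous, and to the jumps when both densities obey the same rule there.

    The finitely many discontinuities of a density are handled by
    [interval_ind_except_finite]: integrability and monotonicity are proved on
    the intervals free of exceptional points and glued at these points. *)

(** * Intervals with finitely many exceptional points *)

(** Induction on the list: an exceptional point inside the interval splits it
    into two intervals on which one exception fewer remains. *)
Lemma interval_ind_except_finite (P : R -> R -> Prop) (s : list R) :
  (forall a b, a < b -> (forall x, a < x < b -> ~ In x s) -> P a b) ->
  (forall a c b, a < c < b -> P a c -> P c b -> P a b) ->
  forall a b, a < b -> P a b.
Proof.
intros Hfree Hjoin; induction s as [|c s IH].
- intros a b Hab; apply Hfree; [exact Hab | intros x _ []].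
- apply IH; intros a b Hab Hs.
  destruct (classic (a < c < b)) as [Hc | Hc].
  + apply (Hjoin a c b Hc); apply Hfree; try lra;
      intros x Hx [-> | Hin]; try lra; apply (Hs x); auto; lra.
  + apply Hfree; [exact Hab |].
    intros x Hx [-> | Hin]; [exact (Hc Hx) | exact (Hs x Hx Hin)].
Qed.

Lemma nonincreasing_except_finite (f : R -> R) (s : list R) (a b : R) :
  a < b ->
  (forall x, a <= x <= b -> continuous f x) ->
  (forall x, a < x < b -> ~ In x s -> exists l, is_derive f x l /\ l <= 0) ->
  f b <= f a.
Proof.
intros Hab Hc Hd.
cut (forall c d, c < d -> a <= c -> d <= b -> f d <= f c).
{ intros H; apply H; lra. }
apply (interval_ind_except_finite
         (fun c d => a <= c -> d <= b -> f d <= f c) s).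
- intros c d Hcd Hs Hac Hdb.
  (* [MVT_gen] may return an endpoint, where [Derive f] is not controlled;
     truncating it at 0 changes nothing inside and fixes the sign there. *)
  destruct (MVT_gen f c d (fun x => Rmin 0 (Derive f x))) as [z [_ Ez]];
    rewrite ?Rmin_left, ?Rmax_right in * by lra.
  + intros x Hx; destruct (Hd x) as [l [Hl Hl0]]; [lra | auto |].
    rewrite (is_derive_unique _ _ _ Hl), Rmin_right by lra; exact Hl.
  + intros x Hx; apply continuity_pt_filterlim, Hc; lra.
  + assert (Rmin 0 (Derive f z) <= 0) by apply Rmin_l; nra.
- intros c m d Hm H1 H2 Hac Hdb.
  apply Rle_trans with (f m); [apply H2 | apply H1]; lra.
Qed.

Lemma locally'_notin (s : list R) x : locally' x (fun y => ~ In y s).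
Proof.
induction s as [|c s IH].
- apply filter_forall; intros y [].
- assert (H : locally' x (fun y => y <> c)).
  { destruct (Req_dec x c) as [-> | Hn]; unfold locally', within.
    - apply filter_forall; auto.
    - generalize (open_neq c x Hn); apply filter_imp; auto. }
  generalize (filter_and _ _ H IH); apply filter_imp.
  intros y [H1 H2] [E | Hi]; auto.
Qed.

(** * Limits within the unit interval *)

Lemma at_right_le_within01 x :
  0 <= x < 1 -> filter_le (at_right x) (within I01 (locally x)).
Proof.
intros Hx Q HQ; unfold at_right, within in *.
assert (Hlt : locally x (fun y => y < 1)) by (apply open_lt; lra).
generalize (filter_and _ _ HQ Hlt); apply filter_imp.
intros y [H1 H2] H3; apply H1; split; lra.
Qed.

Lemma at_left_le_within01 x :
  0 < x <= 1 -> filter_le (at_left x) (within I01 (locally x)).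
Proof.
intros Hx Q HQ; unfold at_left, within in *.
assert (Hlt : locally x (fun y => 0 < y)) by (apply open_gt; lra).
generalize (filter_and _ _ HQ Hlt); apply filter_imp.
intros y [H1 H2] H3; apply H1; split; lra.
Qed.

Lemma at_left_01_notin (s : list R) x :
  0 < x <= 1 -> at_left x (fun y => 0 < y < 1 /\ ~ In y s).
Proof.
intros Hx.
generalize (filter_and (fun y => y <> x -> ~ In y s) _ (locally'_notin s x)
  (open_gt 0 x (proj1 Hx))).
unfold at_left, within; apply filter_imp; intros y [H1 H2] Hy; split; [lra | apply H1; lra].
Qed.

Lemma at_right_01_notin (s : list R) x :
  0 <= x < 1 -> at_right x (fun y => 0 < y < 1 /\ ~ In y s).
Proof.
intros Hx.
generalize (filter_and (fun y => y <> x -> ~ In y s) _ (locally'_notin s x)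
  (open_lt 1 x (proj2 Hx))).
unfold at_right, within; apply filter_imp; intros y [H1 H2] Hy; split; [lra | apply H1; lra].
Qed.

Lemma locally_I01 x : 0 < x < 1 -> locally x I01.
Proof.
intros Hx.
generalize (filter_and _ _ (open_gt 0 x (proj1 Hx)) (open_lt 1 x (proj2 Hx))).
apply filter_imp; intros y [H1 H2]; split; lra.
Qed.

Lemma continuous_in01_interior f x :
  0 < x < 1 -> continuous_in01 f x -> continuous f x.
Proof.
intros Hx Hf Q HQ; specialize (Hf Q HQ).
unfold filtermap, within in *.
generalize (filter_and _ _ Hf (locally_I01 x Hx)); apply filter_imp.
intros y [H1 H2]; auto.
Qed.

(** * Piecewise continuous functions *)

Lemma piecewise_continuous_continuous_on f :
  continuous_on I01 f -> piecewise_continuous f.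
Proof.
intros Hf; split; [| split].
- exists nil; intros x Hx _; exact (Hf x Hx).
- intros x Hx; exists (f x).
  apply (filterlim_filter_le_1 _ (at_right_le_within01 x Hx)), Hf; split; lra.
- intros x Hx; exists (f x).
  apply (filterlim_filter_le_1 _ (at_left_le_within01 x Hx)), Hf; split; lra.
Qed.

Lemma filterlim_Rmult {T : Type} (F : (T -> Prop) -> Prop) {FF : Filter F}
    (f g : T -> R) (l m : R) :
  filterlim f F (locally l) -> filterlim g F (locally m) ->
  filterlim (fun x => f x * g x) F (locally (l * m)).
Proof.
intros Hf Hg.
exact (filterlim_comp_2 f g Rmult Hf Hg (filterlim_mult (K := R_AbsRing) l m)).
Qed.

Lemma piecewise_continuous_mult f g :
  piecewise_continuous f -> piecewise_continuous g ->
  piecewise_continuous (fun x => f x * g x).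
Proof.
intros [[s Hs] [Hr Hl]] [[s' Hs'] [Hr' Hl']]; split; [| split].
- exists (s ++ s'); intros x Hx Hn.
  refine (filterlim_Rmult _ f g _ _ (Hs x Hx _) (Hs' x Hx _));
    intros Hi; apply Hn, in_or_app; auto.
- intros x Hx; destruct (Hr x Hx) as [l Hll], (Hr' x Hx) as [l' Hll'].
  exists (l * l'); apply filterlim_Rmult; auto with typeclass_instances.
- intros x Hx; destruct (Hl x Hx) as [l Hll], (Hl' x Hx) as [l' Hll'].
  exists (l * l'); apply filterlim_Rmult; auto with typeclass_instances.
Qed.

Lemma filterlim_Rinv {T : Type} (F : (T -> Prop) -> Prop) {FF : Filter F}
    (f : T -> R) (l : R) :
  l <> 0 -> filterlim f F (locally l) ->
  filterlim (fun x => / f x) F (locally (/ l)).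
Proof.
intros Hl Hf.
apply (filterlim_comp _ _ _ f Rinv _ _ _ Hf).
apply (filterlim_Rbar_inv (Finite l)).
intros E; injection E; exact Hl.
Qed.

Lemma at_right_I01 x : 0 <= x < 1 -> at_right x I01.
Proof.
intros Hx; apply (at_right_le_within01 x Hx); unfold within; apply filter_forall; auto.
Qed.

Lemma at_left_I01 x : 0 < x <= 1 -> at_left x I01.
Proof.
intros Hx; apply (at_left_le_within01 x Hx); unfold within; apply filter_forall; auto.
Qed.

(** The lower bound of a density passes to its one-sided limits, so these are
    invertible. *)
Lemma piecewise_continuous_inv p :
  density p -> piecewise_continuous (fun x => / p x).
Proof.
intros [[[s Hs] [Hr Hl]] [Hpos [m [Hm Hmp]]]]; split; [| split].
- exists s; intros x Hx Hn.
  refine (filterlim_Rinv _ p _ _ (Hs x Hx Hn)).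
  specialize (Hpos x Hx); lra.
- intros x Hx; destruct (Hr x Hx) as [l Hll]; exists (/ l).
  apply filterlim_Rinv; auto with typeclass_instances.
  assert (m <= l); [| lra].
  refine (filterlim_le (fun _ => m) p (Finite m) (Finite l) _ (filterlim_const m) Hll).
  generalize (at_right_I01 x Hx); apply filter_imp; auto.
- intros x Hx; destruct (Hl x Hx) as [l Hll]; exists (/ l).
  apply filterlim_Rinv; auto with typeclass_instances.
  assert (m <= l); [| lra].
  refine (filterlim_le (fun _ => m) p (Finite m) (Finite l) _ (filterlim_const m) Hll).
  generalize (at_left_I01 x Hx); apply filter_imp; auto.
Qed.

(** Between two consecutive exceptional points the function has a continuous
    extension to the closed interval, because the one-sided limits exist. *)
Lemma piecewise_continuous_ex_RInt f : piecewise_continuous f -> ex_RInt f 0 1.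
Proof.
intros [[s Hs] [Hr Hl]].
cut (forall a b, a < b -> 0 <= a -> b <= 1 -> ex_RInt f a b).
{ intros H; apply H; lra. }
apply (interval_ind_except_finite (fun a b => 0 <= a -> b <= 1 -> ex_RInt f a b) s).
- intros a b Hab Hfree Ha Hb.
  destruct (Hr a) as [r Har]; [lra |]; destruct (Hl b) as [l Hbl]; [lra |].
  destruct (C0_extension_lt f r l a b) as [g [Hgc [Hgf _]]]; auto.
  + intros c Hc; apply continuous_in01_interior; [simpl in Hc; lra |].
    apply Hs; [simpl in Hc; split; lra | apply Hfree; exact Hc].
  + apply ex_RInt_ext with g.
    * rewrite Rmin_left, Rmax_right by lra; intros x Hx; apply Hgf; simpl; lra.
    * apply (ex_RInt_continuous (V := R_CompleteNormedModule)).
      intros z _; apply Hgc.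
- intros a c b Hc H1 H2 Ha Hb; apply ex_RInt_Chasles with c; [apply H1 | apply H2]; lra.
Qed.

(** * Uniqueness for the string equation *)

(** The equation on the open interval, for the real and imaginary parts of a
    solution.  Continuity of [dv] at the discontinuities of [p] is what carries
    uniqueness across the jumps. *)
Definition real_string_solution (p : R -> R) (lambda : R) (v dv : R -> R) : Prop :=
  (forall x, 0 < x < 1 -> continuous dv x) /\
  (forall x, 0 < x < 1 -> is_derive v x (dv x)) /\
  (forall x, 0 < x < 1 -> continuous p x ->
     is_derive dv x (- (lambda * p x * v x))).

(** Gronwall's argument for the energy [E = v^2 + dv^2].  Since
    [E' = 2 v dv (1 - lambda p)], one has [|E'| <= K E] for
    [K = 1 + |lambda| sup p]; so [E exp (- K x)] is nonincreasing and
    [E exp (K x)] is nondecreasing, and [E x0 = 0] propagates to both sides. *)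
Lemma real_string_solution_unique p lambda v dv x0 :
  piecewise_continuous p -> real_string_solution p lambda v dv ->
  0 < x0 < 1 -> v x0 = 0 -> dv x0 = 0 -> forall x, 0 < x < 1 -> v x = 0.
Proof.
intros Hp [Hdc [Hv Hdv]] Hx0 H0 H0' x Hx.
destruct (ex_RInt_ub (V := R_NormedModule) p 0 1 (piecewise_continuous_ex_RInt p Hp))
  as [B HB].
rewrite Rmin_left, Rmax_right in HB by lra.
destruct Hp as [[s Hs] _].
set (K := 1 + Rabs lambda * B).
(* [e = 1] and [e = -1] are the directions to the right and to the left. *)
assert (HE : forall e, e = 1 \/ e = -1 -> forall y, 0 < y < 1 -> ~ In y s ->
  exists l, is_derive
    (fun t => e * ((v t ^ 2 + dv t ^ 2) * exp (- e * K * t))) y l /\ l <= 0).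
{ intros e He y Hy Hys.
  assert (Dv := Hv y Hy).
  assert (Ddv := Hdv y Hy (continuous_in01_interior p y Hy
                   (Hs y (conj (Rlt_le _ _ (proj1 Hy)) (Rlt_le _ _ (proj2 Hy))) Hys))).
  exists (exp (- e * K * y) *
          (2 * e * (v y * dv y * (1 - lambda * p y)) - e * e * K * (v y ^ 2 + dv y ^ 2))).
  split.
  - auto_derive.
    + repeat split; eexists; eassumption.
    + change (fun x => v x) with v; change (fun x => dv x) with dv.
      rewrite (is_derive_unique _ _ _ Dv), (is_derive_unique _ _ _ Ddv); ring.
  - assert (Hexp := exp_pos (- e * K * y)).
    assert (HK : Rabs (1 - lambda * p y) <= K).
    { unfold K. apply Rle_trans with (Rabs 1 + Rabs (- (lambda * p y))).
      - apply Rabs_triang.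
      - rewrite Rabs_R1, Rabs_Ropp, Rabs_mult.
        apply Rplus_le_compat_l, Rmult_le_compat_l; [apply Rabs_pos |].
        apply (HB y); lra. }
    assert (Hee : e * e = 1) by (destruct He; subst; ring).
    rewrite Hee.
    apply Rabs_le_between in HK.
    assert (Hb : 2 * e * (v y * dv y * (1 - lambda * p y)) <= K * (v y ^ 2 + dv y ^ 2)).
    { (* [2 |v dv q| <= K (v^2 + dv^2)] when [|q| <= K]: add two of the
         nonnegative terms [(K +- q) (v +- dv)^2]. *)
      set (q := 1 - lambda * p y) in *.
      assert (0 <= (K - q) * (v y - dv y) ^ 2)
        by (apply Rmult_le_pos; [lra | apply pow2_ge_0]).
      assert (0 <= (K - q) * (v y + dv y) ^ 2)
        by (apply Rmult_le_pos; [lra | apply pow2_ge_0]).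
      assert (0 <= (K + q) * (v y - dv y) ^ 2)
        by (apply Rmult_le_pos; [lra | apply pow2_ge_0]).
      assert (0 <= (K + q) * (v y + dv y) ^ 2)
        by (apply Rmult_le_pos; [lra | apply pow2_ge_0]).
      destruct He; subst e; lra. }
    nra. }
assert (HC : forall e y, 0 < y < 1 ->
  continuous (fun t => e * ((v t ^ 2 + dv t ^ 2) * exp (- e * K * t))) y).
{ intros e y Hy.
  assert (Cv : continuous v y) by (apply (ex_derive_continuous v); eexists; apply Hv; auto).
  assert (Cd := Hdc y Hy).
  apply (continuous_mult (K := R_AbsRing)); [apply continuous_const |].
  apply (continuous_mult (K := R_AbsRing) (fun t => v t ^ 2 + dv t ^ 2)).
  - apply (continuous_ext (fun t => plus (mult (v t) (v t)) (mult (dv t) (dv t)))).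
    { intros t; unfold plus, mult; simpl; ring. }
    apply (continuous_plus (V := R_NormedModule));
      apply (continuous_mult (K := R_AbsRing)); assumption.
  - apply (ex_derive_continuous (fun t => exp (- e * K * t))); auto_derive; auto. }
assert (Hsum : v x ^ 2 + dv x ^ 2 <= 0).
{ destruct (Rtotal_order x0 x) as [Hlt | [<- | Hlt]].
  - assert (H := nonincreasing_except_finite _ s x0 x Hlt
      (fun y Hy => HC 1 y ltac:(lra)) (fun y Hy => HE 1 (or_introl eq_refl) y ltac:(lra))).
    simpl in H; rewrite H0, H0' in H.
    assert (Hexp := exp_pos (- (1) * K * x)); nra.
  - rewrite H0, H0'; lra.
  - assert (H := nonincreasing_except_finite _ s x x0 Hlt
      (fun y Hy => HC (-1) y ltac:(lra)) (fun y Hy => HE (-1) (or_intror eq_refl) y ltac:(lra))).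
    simpl in H; rewrite H0, H0' in H.
    assert (Hexp := exp_pos (- (-1) * K * x)); nra. }
nra.
Qed.

Lemma real_string_solution_zero_interval p lambda v dv a :
  piecewise_continuous p -> real_string_solution p lambda v dv ->
  0 < a < 1 -> locally a (fun x => v x = 0) -> forall x, 0 < x < 1 -> v x = 0.
Proof.
intros Hp Hv Ha H0.
apply (real_string_solution_unique p lambda v dv a Hp Hv Ha).
- exact (locally_singleton _ _ H0).
- rewrite <- (is_derive_unique v a (dv a)) by (apply Hv; exact Ha).
  rewrite (Derive_ext_loc v (fun _ => 0) a H0); apply Derive_const.
Qed.

(** A real eigenvalue decouples the real and imaginary parts: any real-linear
    functional of a solution is a real solution. *)
Lemma string_solution_linear (h : C -> R) p lambda u du :
  is_linear (U := C_R_NormedModule) (V := R_NormedModule) h ->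
  string_solution p (RtoC lambda) u du ->
  real_string_solution p lambda (fun x => h (u x)) (fun x => h (du x)).
Proof.
intros Hh [_ [Hdu [Hd Hdd]]].
assert (Hder : forall (w : R -> C) x l,
  is_derive (K := R_AbsRing) (V := C_R_NormedModule) w x l ->
  is_derive (fun t => h (w t)) x (h l)).
{ intros w x l Hw.
  assert (Hc := filterdiff_comp w h _ h Hw
    (filterdiff_linear (U := C_R_NormedModule) (V := R_NormedModule) h Hh)).
  apply (filterdiff_ext_lin _ _ _ Hc).
  intros t; exact (linear_scal (U := C_R_NormedModule) (V := R_NormedModule) h Hh t l). }
split; [| split].
- intros x Hx; apply (continuous_comp du h).
  + exact (continuous_continuous_on _ _ _ (locally_I01 x Hx) Hdu).
  + exact (linear_cont (U := C_R_NormedModule) (V := R_NormedModule) h (du x) Hh).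
- intros x Hx; apply Hder, Hd, Hx.
- intros x Hx Hp; destruct (Hdd x Hx Hp) as [l [Hl E]].
  replace (- (lambda * p x * h (u x))) with (h l); [apply Hder, Hl |].
  replace l with (@scal R_AbsRing C_R_NormedModule (- (lambda * p x)) (u x)).
  + rewrite (linear_scal (U := C_R_NormedModule) (V := R_NormedModule) h Hh); unfold scal; simpl; unfold mult; simpl; ring.
  + assert (E1 := f_equal fst E); assert (E2 := f_equal snd E); simpl in E1, E2.
    apply injective_projections; unfold scal; simpl; unfold prod_scal, scal; simpl;
      unfold mult; simpl; lra.
Qed.

(** * Weighted means that attain the maximum *)

Lemma RInt_nonneg_eq_0 g x :
  ex_RInt g 0 1 -> (forall y, 0 < y < 1 -> 0 <= g y) -> RInt g 0 1 = 0 ->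
  0 < x < 1 -> continuous g x -> g x = 0.
Proof.
intros Hi Hg H0 Hx Hc.
destruct (Rle_lt_or_eq_dec 0 (g x) (Hg x Hx)) as [Hpos | E]; [exfalso | auto].
assert (Hl : locally x (fun y => g x / 2 < g y)).
{ apply Hc; apply (open_gt (g x / 2) (g x)); lra. }
destruct (filter_and _ _ Hl (locally_I01 x Hx)) as [d Hd].
set (e := d / 2).
assert (He : 0 < e) by (destruct d; unfold e; simpl; lra).
assert (Hb : forall y, x - e <= y <= x + e -> g x / 2 < g y /\ I01 y).
{ intros y Hy; apply Hd; apply Rabs_lt_between'; unfold e in *; simpl in *.
  change (x - d < y < x + d); lra. }
assert (H1 := proj2 (Hb (x - e) ltac:(lra))).
assert (H2 := proj2 (Hb (x + e) ltac:(lra))).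
unfold I01 in H1, H2.
assert (I1 : ex_RInt g 0 (x + e)).
{ apply (ex_RInt_Chasles_1 (V := R_CompleteNormedModule)) with 1; [lra | exact Hi]. }
assert (I2 : ex_RInt g (x + e) 1).
{ apply (ex_RInt_Chasles_2 (V := R_CompleteNormedModule)) with 0; [lra | exact Hi]. }
assert (I3 : ex_RInt g 0 (x - e)).
{ apply (ex_RInt_Chasles_1 (V := R_CompleteNormedModule)) with (x + e); [lra | exact I1]. }
assert (I4 : ex_RInt g (x - e) (x + e)).
{ apply (ex_RInt_Chasles_2 (V := R_CompleteNormedModule)) with 0; [lra | exact I1]. }
assert (P2 : 0 <= RInt g (x + e) 1) by (apply RInt_ge_0; auto; try lra; intros; apply Hg; lra).
assert (P3 : 0 <= RInt g 0 (x - e)) by (apply RInt_ge_0; auto; try lra; intros; apply Hg; lra).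
assert (P4 : RInt (fun _ => g x / 2) (x - e) (x + e) <= RInt g (x - e) (x + e)).
{ apply RInt_le; auto; [lra | apply ex_RInt_const |].
  intros y Hy; left; apply Hb; lra. }
rewrite RInt_const in P4; change scal with Rmult in P4; simpl in P4.
assert (E1 := RInt_Chasles g 0 (x + e) 1 I1 I2).
assert (E2 := RInt_Chasles g 0 (x - e) (x + e) I3 I4).
change plus with Rplus in E1, E2; simpl in E1, E2.
assert (0 < (x + e - (x - e)) * (g x / 2)) by (apply Rmult_lt_0_compat; lra).
unfold mult in P4; simpl in P4.
lra.
Qed.

(** The function [(M - q) w] vanishes at its continuity points.  If [q] is not
    [M] at one of its continuity points, it differs from [M] on a neighbourhood
    that avoids the other exceptional points, so [w] would vanish on that
    neighbourhood, against the hypothesis that it vanishes on no interval. *)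
Lemma weighted_mean_eq_max (q w : R -> R) (M : R) :
  piecewise_continuous q -> continuous_on I01 w ->
  (forall x, 0 < x < 1 -> q x <= M) ->
  (forall x, 0 < x < 1 -> 0 <= w x) ->
  (forall x, 0 < x < 1 -> ~ locally x (fun y => w y = 0)) ->
  RInt (fun x => q x * w x) 0 1 = M * RInt w 0 1 ->
  exists s : list R, forall x, 0 < x < 1 -> ~ In x s -> q x = M.
Proof.
intros Hq Hw HM Hpos Hnz Heq.
assert (Iw := piecewise_continuous_ex_RInt w (piecewise_continuous_continuous_on w Hw)).
assert (Iqw := piecewise_continuous_ex_RInt _
  (piecewise_continuous_mult q w Hq (piecewise_continuous_continuous_on w Hw))).
set (g := fun x => minus (scal M (w x)) (q x * w x)).
assert (IMw : ex_RInt (fun x => scal M (w x)) 0 1).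
{ apply (ex_RInt_scal (V := R_NormedModule)); exact Iw. }
assert (Ig : ex_RInt g 0 1).
{ apply (ex_RInt_minus (V := R_NormedModule)); assumption. }
assert (Hg0 : RInt g 0 1 = 0).
{ unfold g; rewrite (RInt_minus (V := R_CompleteNormedModule)) by assumption.
  rewrite (RInt_scal (V := R_CompleteNormedModule)) by assumption.
  rewrite Heq; unfold minus, plus, opp, scal; simpl; unfold mult; simpl; ring. }
assert (Eg : forall x, g x = (M - q x) * w x).
{ intros x; unfold g, minus, plus, opp, scal; simpl; unfold mult; simpl; ring. }
assert (Hgpos : forall x, 0 < x < 1 -> 0 <= g x).
{ intros x Hx; rewrite Eg; apply Rmult_le_pos; [| auto].
  specialize (HM x Hx); lra. }
destruct Hq as [[s Hs] _]; exists s; intros x Hx Hns.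
assert (Hqc : forall y, 0 < y < 1 -> ~ In y s -> continuous q y).
{ intros y Hy Hys; apply continuous_in01_interior; auto; apply Hs; auto; split; lra. }
apply NNPP; intros Hne; apply (Hnz x Hx).
assert (Hwc : forall y, 0 < y < 1 -> continuous w y).
{ intros y Hy; exact (continuous_continuous_on _ _ _ (locally_I01 y Hy) Hw). }
assert (Hz : forall y, 0 < y < 1 -> ~ In y s -> q y <> M -> w y = 0).
{ intros y Hy Hys HqM.
  assert (g y = 0) as E.
  { apply RInt_nonneg_eq_0; auto.
    apply (continuous_minus (V := R_NormedModule)).
    - apply (continuous_scal_r (V := R_NormedModule)); auto.
    - apply (continuous_mult (K := R_AbsRing)); auto. }
  rewrite Eg in E; apply Rmult_integral in E; destruct E; [lra | assumption]. }
assert (L1 : locally x (fun y => q y <> M)).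
{ exact (Hqc x Hx Hns _ (open_neq M (q x) Hne)). }
assert (L2 : locally x (fun y => ~ In y s)).
{ generalize (locally'_notin s x); unfold locally', within; apply filter_imp.
  intros y H; destruct (Req_dec y x) as [-> | Hyx]; auto. }
generalize (filter_and _ _ (filter_and _ _ L1 L2)
  (filter_and _ _ (open_gt 0 x (proj1 Hx)) (open_lt 1 x (proj2 Hx)))).
apply filter_imp; intros y [[H1 H2] H3]; apply Hz; auto.
Qed.

(** * From a finite exceptional set to all points *)

Lemma filterlim_proportional {T : Type} (F : (T -> Prop) -> Prop)
    {FF : ProperFilter F} (f g : T -> R) (k l m : R) :
  F (fun x => f x = k * g x) ->
  filterlim f F (locally l) -> filterlim g F (locally m) -> l = k * m.
Proof.
intros Heq Hf Hg.
apply (filterlim_locally_unique (K := R_AbsRing) (V := R_NormedModule) (F := F) f);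
  [exact Hf |].
apply (filterlim_ext_loc (fun x => k * g x)).
- revert Heq; apply filter_imp; auto.
- exact (filterlim_Rmult F (fun _ => k) g k m (filterlim_const k) Hg).
Qed.

Lemma proportional_off_finite_extends (f g : R -> R) (k : R) (s : list R) :
  (forall x, 0 < x < 1 -> ~ In x s -> f x = k * g x) ->
  (forall theta : R -> R,
     jump_convention theta f -> jump_convention theta g ->
     forall x, 0 <= x <= 1 -> f x = k * g x) /\
  (forall x, 0 <= x <= 1 -> continuous_in01 f x -> continuous_in01 g x ->
     f x = k * g x).
Proof.
intros Hs.
assert (HR : forall x l m, 0 <= x < 1 -> filterlim f (at_right x) (locally l) ->
  filterlim g (at_right x) (locally m) -> l = k * m).
{ intros x l m Hx; apply (filterlim_proportional (at_right x)).
  generalize (at_right_01_notin s x Hx); apply filter_imp; intros y []; auto. }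
assert (HL : forall x l m, 0 < x <= 1 -> filterlim f (at_left x) (locally l) ->
  filterlim g (at_left x) (locally m) -> l = k * m).
{ intros x l m Hx; apply (filterlim_proportional (at_left x)).
  generalize (at_left_01_notin s x Hx); apply filter_imp; intros y []; auto. }
split.
- intros theta [F0 [F1 F]] [G0 [G1 G]] x Hx.
  destruct (Req_dec x 0) as [-> | H0]; [apply (HR 0); auto; lra |].
  destruct (Req_dec x 1) as [-> | H1]; [apply (HL 1); auto; lra |].
  destruct (F x) as [l [r [Fl [Fr ->]]]]; [lra |].
  destruct (G x) as [l' [r' [Gl [Gr ->]]]]; [lra |].
  rewrite (HL x l l'), (HR x r r') by (auto; lra); ring.
- intros x Hx Hf Hg.
  destruct (Rlt_dec x 1) as [H1 | H1].
  + apply (HR x); [lra | |];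
      apply (filterlim_filter_le_1 _ (at_right_le_within01 x (conj (proj1 Hx) H1)));
      assumption.
  + assert (H0 : 0 < x <= 1) by lra.
    apply (HL x); [lra | |];
      apply (filterlim_filter_le_1 _ (at_left_le_within01 x H0)); assumption.
Qed.

(** * Inner products as real integrals *)

Lemma RInt_RtoC f a b :
  ex_RInt f a b ->
  RInt (V := C_R_CompleteNormedModule) (fun x => RtoC (f x)) a b = RtoC (RInt f a b).
Proof.
intros Hf; apply is_RInt_unique.
apply (is_RInt_fct_extend_pair (U := R_NormedModule) (V := R_NormedModule)); simpl.
- exact (RInt_correct f a b Hf).
- generalize (is_RInt_const a b (0 : R_NormedModule)).
  unfold scal; simpl; unfold mult; simpl; rewrite Rmult_0_r; auto.
Qed.

Definition abs_sq (u : R -> C) (x : R) : R := fst (u x) ^ 2 + snd (u x) ^ 2.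

Lemma continuous_on_abs_sq u : continuous_on I01 u -> continuous_on I01 (abs_sq u).
Proof.
intros Hu x Hx.
assert (Hf : filterlim (fun t => fst (u t)) (within I01 (locally x)) (locally (fst (u x)))).
{ apply (filterlim_comp _ _ _ u fst _ _ _ (Hu x Hx)); apply continuous_fst. }
assert (Hg : filterlim (fun t => snd (u t)) (within I01 (locally x)) (locally (snd (u x)))).
{ apply (filterlim_comp _ _ _ u snd _ _ _ (Hu x Hx)); apply continuous_snd. }
apply (filterlim_ext (fun t => fst (u t) * fst (u t) + snd (u t) * snd (u t))).
{ intros t; unfold abs_sq; ring. }
replace (abs_sq u x) with (fst (u x) * fst (u x) + snd (u x) * snd (u x))
  by (unfold abs_sq; ring).
exact (filterlim_comp_2 _ _ Rplus (filterlim_Rmult _ _ _ _ _ Hf Hf)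
  (filterlim_Rmult _ _ _ _ _ Hg Hg)
  (filterlim_plus (V := R_NormedModule) _ _)).
Qed.

Lemma inner_weighted (q : R -> R) (u : R -> C) :
  piecewise_continuous q -> continuous_on I01 u ->
  inner (fun x => RtoC (q x) * u x)%C u = RtoC (RInt (fun x => q x * abs_sq u x) 0 1).
Proof.
intros Hq Hu; unfold inner; rewrite <- RInt_RtoC.
- apply (RInt_ext (V := C_R_CompleteNormedModule)); intros x _.
  unfold abs_sq, Cconj, RtoC, Cmult; destruct (u x) as [a b]; simpl; f_equal; ring.
- apply piecewise_continuous_ex_RInt, piecewise_continuous_mult; [exact Hq |].
  apply piecewise_continuous_continuous_on, continuous_on_abs_sq, Hu.
Qed.

Lemma inner_self u :
  continuous_on I01 u -> inner u u = RtoC (RInt (abs_sq u) 0 1).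
Proof.
intros Hu; unfold inner; rewrite <- RInt_RtoC.
- apply (RInt_ext (V := C_R_CompleteNormedModule)); intros x _.
  unfold abs_sq, Cconj, RtoC, Cmult; destruct (u x) as [a b]; simpl; f_equal; ring.
- apply piecewise_continuous_ex_RInt.
  apply piecewise_continuous_continuous_on, continuous_on_abs_sq, Hu.
Qed.

(** * Eigenfunctions do not vanish on an interval *)

Lemma string_solution_zero_interval p lambda u du a :
  piecewise_continuous p -> string_solution p (RtoC lambda) u du -> 0 < a < 1 ->
  locally a (fun x => abs_sq u x = 0) -> forall x, 0 < x < 1 -> abs_sq u x = 0.
Proof.
intros Hp Hu Ha H0 x Hx; unfold abs_sq in *.
rewrite (real_string_solution_zero_interval p lambda _ _ a Hp
           (string_solution_linear fst p lambda u du
              (is_linear_fst (U := R_NormedModule) (V := R_NormedModule)) Hu) Ha) by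
  (auto; revert H0; apply filter_imp; intros y Hy; nra).
rewrite (real_string_solution_zero_interval p lambda _ _ a Hp
           (string_solution_linear snd p lambda u du
              (is_linear_snd (U := R_NormedModule) (V := R_NormedModule)) Hu) Ha) by
  (auto; revert H0; apply filter_imp; intros y Hy; nra).
ring.
Qed.

(** * Rigidity of the density *)

Theorem theorem2p3 :
  forall (alpha beta : R) (p pt : R -> R) (n : nat)
         (lam lamt : nat -> R) (phi dphi : R -> C) (M : R),
    0 < alpha <= PI ->
    0 <= beta < PI ->
    density p ->
    density pt ->
    (0 < n)%nat ->
    eigenvalue_sequence p alpha beta lam ->
    eigenvalue_sequence pt alpha beta lamt ->
    eigenfunction pt alpha beta (RtoC (lamt n)) phi dphi ->
    phi 0 = RtoC (sin alpha) ->
    dphi 0 = RtoC (- cos alpha) ->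
    let pc := fun x => pt x / p x in
    lam n <> 0 ->
    RtoC (lam n) =
      (RtoC (lamt n) *
        (inner (fun x => RtoC (pc x) * phi x) phi / inner phi phi))%C ->
    is_max01 pc M ->
    lam n = lamt n * M ->
    (* everywhere on [0,1], when [p] and [pt] take their values at the jumps
       by the same convention *)
    (forall theta : R -> R,
       jump_convention theta p -> jump_convention theta pt ->
       forall x, 0 <= x <= 1 -> p x = lamt n / lam n * pt x) /\
    (* with arbitrary values at the jumps *)
    (forall x, 0 <= x <= 1 -> continuous_in01 p x -> continuous_in01 pt x ->
       p x = lamt n / lam n * pt x).
Proof.
intros alpha beta p pt n lam lamt phi dphi M _ _ Hp Hpt _ _ _ [[Hsol _] _] _ _
  pc Hlam Hmean [_ Hmax] HM.
assert (Hpc : piecewise_continuous pc).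
{ exact (piecewise_continuous_mult pt _ (proj1 Hpt) (piecewise_continuous_inv p Hp)). }
assert (Hphi : continuous_on I01 phi) by apply Hsol.
rewrite (inner_weighted pc phi Hpc Hphi), (inner_self phi Hphi) in Hmean.
set (I := RInt (fun x => pc x * abs_sq phi x) 0 1) in *.
set (J := RInt (abs_sq phi) 0 1) in *.
assert (Hlamt : lamt n <> 0).
{ intros E; apply Hlam; rewrite HM, E; ring. }
assert (HJ : J <> 0).
{ (* With [J = 0] the quotient in [Hmean] is a division by zero, equal to 0. *)
  intros E; apply Hlam; rewrite E in Hmean.
  apply (f_equal fst) in Hmean; simpl in Hmean; unfold Rdiv in Hmean.
  rewrite Hmean; ring. }
assert (HI : @eq R I (M * J)).
{ rewrite <- RtoC_div, <- RtoC_mult in Hmean by exact HJ.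
  apply RtoC_inj in Hmean; rewrite HM in Hmean.
  apply Rmult_eq_reg_l in Hmean; [| exact Hlamt].
  rewrite Hmean; unfold Rdiv; rewrite Rmult_assoc, Rinv_l, Rmult_1_r; auto. }
destruct (weighted_mean_eq_max pc (abs_sq phi) M) as [s Hs]; auto.
- exact (continuous_on_abs_sq phi Hphi).
- intros x Hx; apply Hmax; split; lra.
- intros x _; unfold abs_sq; nra.
- intros a Ha H0; apply HJ; unfold J.
  rewrite (RInt_ext _ (fun _ => 0)), RInt_const.
  + apply Rmult_0_r.
  + rewrite Rmin_left, Rmax_right by lra.
    exact (string_solution_zero_interval pt (lamt n) phi dphi a (proj1 Hpt) Hsol Ha H0).
- apply (proportional_off_finite_extends p pt (lamt n / lam n) s).
  intros x Hx Hxs; specialize (Hs x Hx Hxs); unfold pc in Hs.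
  assert (Hpx : 0 < p x) by (apply Hp; split; lra).
  rewrite HM, <- Hs; field.
  assert (Hptx : 0 < pt x) by (apply Hpt; split; lra).
  repeat split; lra.
Qed.
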